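(* Let $n\ge1$, let $k_0\le0$ and $a\ge0$ be real numbers, let $V_q(k)=a(k-k_0)^2$ for $k\in\{0,\dots,n\}$, and let $|\psi_{q,a}\rangle$ denote the ground state of $H=-A_{hc}+V_q$. Then there exists $m^*(a)\in[0,n/2]$ such that $$\bigl|\langle\psi_{q,a}|\varphi_{m^*(a)}\rangle\bigr|^2\ \ge\ \frac12 .$$
   Context: The space is $\mathbb{C}^{n+1}$ with orthonormal basis $|0\rangle,\dots,|n\rangle$. $A_{hc}$ is the matrix with $(A_{hc})_{k-1,k}=(A_{hc})_{k,k-1}=\sqrt{k(n+1-k)}$ for $1\le k\le n$, all other entries being $0$; $V_q$ is identified with the diagonal matrix with entries $V_q(0),\dots,V_q(n)$. The ground state is the normalized eigenvector of the (simple) lowest eigenvalue, chosen with positive entries. For $m\in[0,n/2]$ the binomial state is $$|\varphi_m\rangle=\sum_{k=0}^n\sqrt{\binom nk}\left(\frac mn\right)^{k/2}\left(1-\frac mn\right)^{(n-k)/2}|k\rangle,$$ with the convention $0^0=1$. *)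

(* Defs.v *)
From HB Require Import structures.
From mathcomp Require Import all_boot all_order all_algebra.
From mathcomp Require Import all_classical all_reals all_analysis.
From mathcomp Require Import complex.

Set Implicit Arguments.
Unset Strict Implicit.
Unset Printing Implicit Defensive.

Import Order.TTheory GRing.Theory Num.Theory.

Local Open Scope ring_scope.
Local Open Scope complex_scope.
Local Open Scope sesquilinear_scope.

(* The ket |k> is the k-th standard basis vector of 'cV[R[i]]_n.+1, so the
   indices k = 0, ..., n are the elements of 'I_n.+1. *)

Definition braket (R : realType) (N : nat) (u v : 'cV[R[i]]_N) : R[i] :=
  (u ^t* *m v) ord0 ord0.

Definition Ahc_weight (R : realType) (n k : nat) : R :=
  Num.sqrt (k%:R * (n%:R + 1 - k%:R)).

Definition Ahc (R : realType) (n : nat) : 'M[R[i]]_n.+1 :=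
  \matrix_(i, j)
    if (j : nat) == i.+1 then (Ahc_weight R n j)%:C
    else if (i : nat) == j.+1 then (Ahc_weight R n i)%:C
    else 0.

Definition Vq (R : realType) (a k0 : R) (k : nat) : R := a * (k%:R - k0) ^+ 2.

Definition potential_mx (R : realType) (n : nat) (V : nat -> R) :
    'M[R[i]]_n.+1 :=
  diag_mx (\row_k (V k)%:C).

Definition Hq (R : realType) (n : nat) (a k0 : R) : 'M[R[i]]_n.+1 :=
  - Ahc R n + potential_mx n (Vq a k0).

(* In R[i], x <= y means that y - x is a nonnegative real. *)
Definition lowest_eigenvalue (R : realType) (N : nat) (H : 'M[R[i]]_N)
    (E : R[i]) : Prop :=
  eigenvalue H E /\ forall E' : R[i], eigenvalue H E' -> E <= E'.

(* Simplicity of the lowest eigenvalue is not required: it is a property of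
   the matrices Hq, not part of what singles out the vector. *)
Definition ground_state (R : realType) (N : nat) (H : 'M[R[i]]_N)
    (psi : 'cV[R[i]]_N) : Prop :=
  exists E : R[i],
    [/\ lowest_eigenvalue H E,
        H *m psi = E *: psi,
        braket psi psi = 1 &
        forall k : 'I_N, 0 < psi k ord0].

(* [powR] satisfies 0 `^ 0 = 1, and 0 `^ x = 0 for x != 0. *)
Definition binomial_state (R : realType) (n : nat) (m : R) :
    'cV[R[i]]_n.+1 :=
  \col_(k < n.+1)
    (Num.sqrt ('C(n, k)%:R)
     * (m / n%:R) `^ (k%:R / 2)
     * (1 - m / n%:R) `^ ((n%:R - k%:R) / 2))%:C.

(* Main.v *)
(** Write p = m/n, s = sqrt p, t = sqrt (1 - p), mu = n p. The binomial state
    phi with parameter p is the ground state of -A_hc + c k with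
    c = t/s - s/t, whose spectral gap is 1/(s t). Choose p in (0, 1/2] so that c
    is the slope of V_q at mu; then V_q is c k + a (k - mu)^2 up to a constant,
    and comparing the energies of psi and phi for both Hamiltonians gives
    (1 - |<psi|phi>|^2) / (s t) <= a Var phi <= a n p (1 - p). The tangency
    condition 2 a (mu - k_0) s t = 1 - 2 p and k_0 <= 0 bound the right-hand
    side by 1/(2 s t).

    No spectral theory is needed. Conjugation by a positive eigenvector x turns
    the quadratic form of a Jacobi matrix into
    E |y|^2 + sum_k w_(k+1) x_k x_(k+1) (y_(k+1)/x_(k+1) - y_k/x_k)^2.
    For x = psi this is the variational principle; for x = phi the last sum is
    the Dirichlet form of the binomial distribution, and the gap is its Poincare
    inequality. *)
Require Import Defs.
From mathcomp Require Import all_boot all_order all_algebra.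
From mathcomp Require Import all_classical all_reals all_analysis.
From mathcomp Require Import complex ring lra.

Set Implicit Arguments.
Unset Strict Implicit.

Import Order.TTheory GRing.Theory Num.Theory.
Import numFieldNormedType.Exports.

Local Open Scope ring_scope.
Local Open Scope complex_scope.

(** * Mean and variance under the binomial law *)

Definition binomial_mean (R : realType) (p : R) (n : nat) (h : nat -> R) : R :=
  \sum_(k < n.+1) 'C(n, k)%:R * p ^+ k * (1 - p) ^+ (n - k) * h k.

(** Pascal's rule, read as conditioning on one Bernoulli trial: a success shifts the argument of [h]
    by one. *)
Lemma binomial_meanS (R : realType) (p : R) (n : nat) (h : nat -> R) :
  binomial_mean p n.+1 h =
  p * binomial_mean p n (h \o succn) + (1 - p) * binomial_mean p n h.
Proof.
rewrite /binomial_mean big_ord_recl /= !mulr_sumr bin0 expr0 subn0 mul1r.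
under eq_bigr => k _ do
  rewrite /bump /= add1n binS natrD 3!mulrDl subSS.
rewrite big_split /= [RHS]addrC.
rewrite [X in _ = X + _]big_ord_recl /= bin0 expr0 subn0 addrA; congr (_ + _).
  rewrite big_ord_recr /= bin_small // !mul0r addr0.
  congr (_ + _); first by rewrite exprS; ring.
  apply: eq_bigr => k _; rewrite /bump /= add1n.
  by rewrite -(subnSK (ltn_ord k)) [(1 - p) ^+ _]exprS; ring.
by apply: eq_bigr => k _ /=; rewrite exprS; ring.
Qed.

Lemma binomial_mean_ext (R : realType) (p : R) (n : nat) (h h' : nat -> R) :
  h =1 h' -> binomial_mean p n h = binomial_mean p n h'.
Proof. by move=> hh; apply: eq_bigr => k _; rewrite hh. Qed.

Lemma binomial_mean0 (R : realType) (p : R) (h : nat -> R) :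
  binomial_mean p 0 h = h 0%N.
Proof. by rewrite /binomial_mean big_ord1 bin0 !expr0 !mul1r. Qed.

Lemma binomial_meanB (R : realType) (p : R) (n : nat) (h h' : nat -> R) :
  binomial_mean p n (fun k => h k - h' k) =
  binomial_mean p n h - binomial_mean p n h'.
Proof.
rewrite /binomial_mean -sumrB; apply: eq_bigr => k _; ring.
Qed.

Lemma binomial_mean_cst (R : realType) (p : R) (n : nat) (c : R) :
  binomial_mean p n (fun=> c) = c.
Proof.
elim: n => [|n IHn]; first exact: binomial_mean0.
rewrite binomial_meanS (_ : (fun=> c) \o succn = fun=> c) // IHn; ring.
Qed.

Lemma binomial_mean_id (R : realType) (p : R) (n : nat) :
  binomial_mean p n (fun k => k%:R) = n%:R * p.
Proof.
elim: n => [|n IHn]; first by rewrite binomial_mean0 mul0r.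
have -> : binomial_mean p n.+1 (fun k => k%:R) =
    p * binomial_mean p n (fun k => k%:R - (-1)) +
    (1 - p) * binomial_mean p n (fun k => k%:R).
  rewrite binomial_meanS; congr (p * _ + _).
  by apply: binomial_mean_ext => k /=; rewrite opprK natr1.
rewrite binomial_meanB binomial_mean_cst IHn -natr1; ring.
Qed.

Definition binomial_var (R : realType) (p : R) (n : nat) (h : nat -> R) : R :=
  binomial_mean p n (fun k => h k ^+ 2) - binomial_mean p n h ^+ 2.

Lemma binomial_mean_ge0 (R : realType) (p : R) (n : nat) (h : nat -> R) :
  0 <= p <= 1 -> (forall k, 0 <= h k) -> 0 <= binomial_mean p n h.
Proof.
case/andP=> p0 p1 h0; apply: sumr_ge0 => k _.
by rewrite !mulr_ge0 ?exprn_ge0 ?subr_ge0.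
Qed.

Lemma binomial_mean_sqr_le (R : realType) (p : R) (n : nat) (h : nat -> R) :
  0 <= p <= 1 ->
  binomial_mean p n h ^+ 2 <= binomial_mean p n (fun k => h k ^+ 2).
Proof.
move=> p01; set e := binomial_mean p n h.
have := @binomial_mean_ge0 R p n (fun k => (h k - e) ^+ 2) p01
  (fun k => sqr_ge0 _).
suff -> : binomial_mean p n (fun k => (h k - e) ^+ 2) =
    binomial_mean p n (fun k => h k ^+ 2) - e ^+ 2 by rewrite subr_ge0.
transitivity (binomial_mean p n (fun k => h k ^+ 2)
   - 2 * e * binomial_mean p n h
   + e ^+ 2 * binomial_mean p n (fun=> 1)); last first.
  by rewrite binomial_mean_cst -/e; ring.
move: e => e; rewrite /binomial_mean !mulr_sumr -sumrB -big_split /=.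
by apply: eq_bigr => k _; ring.
Qed.

(* Efron-Stein by induction on n: condition on the last Bernoulli trial. *)
Lemma binomial_poincare (R : realType) (p : R) (n : nat) (h : nat -> R) :
  0 <= p <= 1 ->
  binomial_var p n.+1 h <=
  n.+1%:R * p * (1 - p) * binomial_mean p n (fun k => (h k.+1 - h k) ^+ 2).
Proof.
move=> p01; have /andP[p0 p1] := p01; have q0 : 0 <= 1 - p by rewrite subr_ge0.
pose d (h : nat -> R) k := (h k.+1 - h k) ^+ 2.
rewrite -/(d h).
(* Law of total variance for one trial: the variance between the two outcomes is p (1 - p) times the
   squared difference of the conditional means, and Jensen's inequality bounds that square by the
   mean of [d f]. *)
have step m (f : nat -> R) : binomial_var p m.+1 f <=
    p * binomial_var p m (f \o succn) + (1 - p) * binomial_var p m f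
    + p * (1 - p) * binomial_mean p m (d f).
  have := binomial_mean_sqr_le m (fun k => (f \o succn) k - f k) p01.
  rewrite binomial_meanB -/(d f) /binomial_var !binomial_meanS.
  rewrite -[(fun k => f k ^+ 2) \o succn]/(fun k => (f \o succn) k ^+ 2).
  set A := binomial_mean p m (fun k => (f \o succn) k ^+ 2).
  set B := binomial_mean p m (fun k => f k ^+ 2).
  set a := binomial_mean p m (f \o succn); set b := binomial_mean p m f.
  move=> /(ler_wpM2l (mulr_ge0 p0 q0)).
  rewrite -[X in _ <= _ * X -> _]/(binomial_mean p m (d f)) => le_d.
  rewrite -subr_ge0 in le_d; rewrite -subr_ge0.
  by apply: le_trans le_d _; rewrite le_eqVlt; apply/orP; left; apply/eqP; ring.
elim: n h => [|n IHn] h.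
  apply: le_trans (step 0%N h) _.
  by rewrite /binomial_var !binomial_mean0 /= !subrr !mulr0 !add0r mul1r.
apply: le_trans (step n.+1 h) _.
have /(ler_wpM2l p0) h1 := IHn (h \o succn).
have /(ler_wpM2l q0) h2 := IHn h.
apply: le_trans (lerD (lerD h1 h2) (lexx _)) _.
rewrite [in leRHS]binomial_meanS [in leLHS]binomial_meanS.
rewrite -[d (h \o succn)]/(d h \o succn).
by rewrite -[n.+2%:R]natr1 le_eqVlt; apply/orP; left; apply/eqP; ring.
Qed.

(** * Quadratic forms of Jacobi matrices *)

(* In all uses w 0 = w n.+1 = 0, which cancels the junk values x 0.-1 = x 0 and
   x n.+1. *)
Definition jacobi_eigen (R : realType) (n : nat) (w V : nat -> R) (E : R)
    (x : nat -> R) : Prop :=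
  forall k, (k <= n)%N ->
    V k * x k - (w k * x k.-1 + w k.+1 * x k.+1) = E * x k.

Definition jacobi_form (R : realType) (n : nat) (w V x : nat -> R) : R :=
  \sum_(k < n.+1) V k * x k ^+ 2 - 2 * \sum_(k < n) w k.+1 * x k * x k.+1.

(** Multiplying the eigenvalue equation at [k] by x_k r_k^2 trades the potential for [E] and two
    neighbour terms; with the hopping term, these complete a square on each edge. Taking the ratio
    [r] as the variable avoids division. *)
Lemma jacobi_ground_state_transform (R : realType) (n : nat) (w V : nat -> R)
    (E : R) (x r : nat -> R) :
  w 0%N = 0 -> w n.+1 = 0 -> jacobi_eigen n w V E x ->
  jacobi_form n w V (fun k => x k * r k) =
  E * (\sum_(k < n.+1) (x k * r k) ^+ 2)
  + \sum_(k < n) w k.+1 * x k * x k.+1 * (r k.+1 - r k) ^+ 2.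
Proof.
move=> w0 wn xE; rewrite /jacobi_form.
have -> : \sum_(k < n.+1) V k * (x k * r k) ^+ 2 =
    E * (\sum_(k < n.+1) (x k * r k) ^+ 2) +
    (\sum_(k < n.+1) w k * x k.-1 * x k * r k ^+ 2 +
     \sum_(k < n.+1) w k.+1 * x k * x k.+1 * r k ^+ 2).
  rewrite mulr_sumr -!big_split /=; apply: eq_bigr => k _.
  have e : V k * x k = E * x k + (w k * x k.-1 + w k.+1 * x k.+1).
    by rewrite -xE ?subrK // -ltnS.
  transitivity (V k * x k * (x k * r k ^+ 2)); first by ring.
  by rewrite e; ring.
rewrite -addrA; congr (_ + _).
(* One sum loses its first term and the other its last, so that both run over the [n] edges. *)
rewrite [\sum_(k < n.+1) w k * x k.-1 * x k * r k ^+ 2]big_ord_recl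
  [\sum_(k < n.+1) w k.+1 * x k * x k.+1 * r k ^+ 2]big_ord_recr /= w0 wn.
rewrite !mul0r add0r addr0 mulr_sumr -big_split -sumrB /=.
by apply: eq_bigr => k _; rewrite /bump /= add1n /=; ring.
Qed.

(** Variational principle: for r = y/x, the edge squares carry nonnegative weights because [x] is
    positive. *)
Lemma jacobi_form_min (R : realType) (n : nat) (w V : nat -> R)
    (E : R) (x y : nat -> R) :
  (forall k, 0 <= w k) -> w 0%N = 0 -> w n.+1 = 0 -> jacobi_eigen n w V E x ->
  (forall k, (k <= n)%N -> 0 < x k) ->
  E * (\sum_(k < n.+1) y k ^+ 2) <= jacobi_form n w V y.
Proof.
move=> wge0 w0 wn xE xpos.
have yE k : (k <= n)%N -> x k * (y k / x k) = y k.
  by move=> /xpos xk; rewrite mulrC divfK // gt_eqF.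
have := jacobi_ground_state_transform (fun k => y k / x k) w0 wn xE.
have -> : jacobi_form n w V (fun k => x k * (y k / x k)) = jacobi_form n w V y.
  rewrite /jacobi_form; congr (_ - 2 * _); apply: eq_bigr => k _.
    by rewrite yE // -ltnS.
  by rewrite -mulrA yE 1?ltnW // yE // mulrA.
have -> : \sum_(k < n.+1) (x k * (y k / x k)) ^+ 2 = \sum_(k < n.+1) y k ^+ 2.
  by apply: eq_bigr => k _; rewrite yE // -ltnS.
move=> ->; rewrite lerDl; apply: sumr_ge0 => k _.
have [x0 x1] := (xpos _ (ltnW (ltn_ord k)), xpos _ (ltn_ord k)).
by apply: mulr_ge0; rewrite ?sqr_ge0 // mulr_ge0 ?mulr_ge0 ?(ltW x0) ?(ltW x1).
Qed.

Lemma jacobi_form_eigen (R : realType) (n : nat) (w V : nat -> R)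
    (E : R) (x : nat -> R) :
  w 0%N = 0 -> w n.+1 = 0 -> jacobi_eigen n w V E x ->
  jacobi_form n w V x = E * \sum_(k < n.+1) x k ^+ 2.
Proof.
move=> w0 wn xE.
have := jacobi_ground_state_transform (fun=> 1) w0 wn xE.
under eq_bigr do rewrite mulr1.
rewrite [X in _ + X]big1 ?addr0 => [|k _]; last by rewrite subrr expr0n mulr0.
move=> <-; rewrite /jacobi_form.
by congr (_ - 2 * _); apply: eq_bigr => k _; rewrite !mulr1.
Qed.

Lemma jacobi_formB (R : realType) (n : nat) (w V V' x : nat -> R) :
  jacobi_form n w V x - jacobi_form n w V' x =
  \sum_(k < n.+1) (V k - V' k) * x k ^+ 2.
Proof.
rewrite /jacobi_form opprB addrA subrK -sumrB.
by apply: eq_bigr => k _; rewrite mulrBl.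
Qed.

(** * The binomial state as an eigenvector for a linear potential *)

Lemma Ahc_weight0 (R : realType) (n : nat) : Ahc_weight R n 0 = 0.
Proof. by rewrite /Ahc_weight mul0r sqrtr0. Qed.

Lemma Ahc_weightS (R : realType) (n : nat) : Ahc_weight R n n.+1 = 0.
Proof. by rewrite /Ahc_weight -natr1 subrr mulr0 sqrtr0. Qed.

(** Amplitudes of the binomial state for s = sqrt p and t = sqrt (1 - p). Separate parameters [s]
    and [t] keep all exponents natural. *)
Definition coherent (R : realType) (s t : R) (n k : nat) : R :=
  Num.sqrt 'C(n, k)%:R * s ^+ k * t ^+ (n - k).

Lemma coherent_gt0 (R : realType) (s t : R) (n k : nat) :
  0 < s -> 0 < t -> (k <= n)%N -> 0 < coherent s t n k.
Proof.
by move=> s0 t0 kn; rewrite !mulr_gt0 ?exprn_gt0 // sqrtr_gt0 ltr0n bin_gt0.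
Qed.

(** The identity (k+1) C(n,k+1) = (n-k) C(n,k) makes the product under the root a perfect square
    times one binomial coefficient. *)
Lemma Ahc_weight_sqrt_bin (R : realType) (n k : nat) : (k < n)%N ->
  Ahc_weight R n k.+1 * Num.sqrt 'C(n, k.+1)%:R =
    (n%:R - k%:R) * Num.sqrt 'C(n, k)%:R /\
  Ahc_weight R n k.+1 * Num.sqrt 'C(n, k)%:R =
    k.+1%:R * Num.sqrt 'C(n, k.+1)%:R.
Proof.
move=> kn; have nk0 : 0 <= n%:R - k%:R :> R by rewrite subr_ge0 ler_nat ltnW.
have e : k.+1%:R * 'C(n, k.+1)%:R = (n%:R - k%:R) * 'C(n, k)%:R :> R.
  by rewrite -natrB 1?ltnW // -!natrM mul_bin_left.
have -> : Ahc_weight R n k.+1 = Num.sqrt (k.+1%:R * (n%:R - k%:R)).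
  by rewrite /Ahc_weight -natr1; congr (Num.sqrt (_ * _)); ring.
split; rewrite -sqrtrM ?mulr_ge0 //.
  by rewrite mulrAC e mulrAC sqrtrM -?expr2 ?sqr_ge0 // sqrtr_sqr ger0_norm.
by rewrite -mulrA -e mulrA -expr2 sqrtrM ?sqr_ge0 // sqrtr_sqr ger0_norm.
Qed.

Lemma Ahc_coherentS (R : realType) (s t : R) (n k : nat) : (k < n)%N ->
  t != 0 ->
  Ahc_weight R n k.+1 * coherent s t n k.+1 =
  (n%:R - k%:R) * (s / t) * coherent s t n k.
Proof.
move=> kn t0; rewrite /coherent [LHS]mulrA [X in X * _ = _]mulrA.
rewrite (Ahc_weight_sqrt_bin R kn).1.
by rewrite -(subnSK kn) !exprS; field.
Qed.

Lemma Ahc_coherent (R : realType) (s t : R) (n k : nat) : (k < n)%N ->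
  s != 0 ->
  Ahc_weight R n k.+1 * coherent s t n k =
  k.+1%:R * (t / s) * coherent s t n k.+1.
Proof.
move=> kn s0; rewrite /coherent [LHS]mulrA [X in X * _ = _]mulrA.
rewrite (Ahc_weight_sqrt_bin R kn).2.
by rewrite -(subnSK kn) !exprS; field.
Qed.

(** The neighbour terms are k t/s and (n-k) s/t times the entry at [k]. Their sum is affine in [k],
    and the linear potential cancels its slope. *)
Lemma coherent_eigen (R : realType) (s t : R) (n : nat) :
  s != 0 -> t != 0 ->
  jacobi_eigen n (Ahc_weight R n) (fun k => (t / s - s / t) * k%:R)
    (- (n%:R * (s / t))) (coherent s t n).
Proof.
move=> s0 t0 k kn.
have -> : Ahc_weight R n k * coherent s t n k.-1 =
    k%:R * (t / s) * coherent s t n k.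
  by case: k kn => [|k] kn; [rewrite Ahc_weight0 !mul0r | exact: Ahc_coherent].
have -> : Ahc_weight R n k.+1 * coherent s t n k.+1 =
    (n%:R - k%:R) * (s / t) * coherent s t n k.
  move: kn; rewrite leq_eqVlt => /predU1P[->|kn]; last exact: Ahc_coherentS.
  by rewrite Ahc_weightS subrr !mul0r.
ring.
Qed.

Lemma coherent_sqr (R : realType) (s t : R) (n k : nat) : (k <= n)%N ->
  s ^+ 2 + t ^+ 2 = 1 ->
  coherent s t n k ^+ 2 =
  'C(n, k)%:R * (s ^+ 2) ^+ k * (1 - s ^+ 2) ^+ (n - k).
Proof.
move=> kn st; have -> : 1 - s ^+ 2 = t ^+ 2 by rewrite -st; ring.
rewrite -!exprM (mulnC 2) [(2 * _)%N]mulnC !exprM /coherent.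
by rewrite -[in RHS](@sqr_sqrtr R 'C(n, k)%:R) // -!exprMn.
Qed.

(** By (n+1-k) C(n+1,k) = (n+1) C(n,k), the edge weights form a multiple of the binomial law with
    one trial fewer, as in the right-hand side of [binomial_poincare]. *)
Lemma coherent_hop (R : realType) (s t : R) (n k : nat) : (k <= n)%N ->
  t != 0 -> s ^+ 2 + t ^+ 2 = 1 ->
  Ahc_weight R n.+1 k.+1 * coherent s t n.+1 k * coherent s t n.+1 k.+1 =
  n.+1%:R * (s * t) *
    ('C(n, k)%:R * (s ^+ 2) ^+ k * (1 - s ^+ 2) ^+ (n - k)).
Proof.
move=> kn t0 st; rewrite mulrAC Ahc_coherentS // .
rewrite -[LHS]mulrA -[X in _ * X = _]expr2.
rewrite coherent_sqr 1?leqW // subSn // [_ ^+ (n - k).+1]exprS.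
have e : (n.+1%:R - k%:R) * 'C(n.+1, k)%:R = n.+1%:R * 'C(n, k)%:R :> R.
  by rewrite -natrB 1?leqW // -!natrM -mul_bin_down.
transitivity ((n.+1%:R - k%:R) * 'C(n.+1, k)%:R * (s / t) * (1 - s ^+ 2)
  * (s ^+ 2) ^+ k * (1 - s ^+ 2) ^+ (n - k)); first by ring.
have q : 1 - s ^+ 2 = t ^+ 2 by rewrite -st; ring.
by rewrite e q; field.
Qed.

(** * Spectral gap and overlap bound *)

(** For h = u/x, the bracket is the binomial variance of [h], and the excess energy of [u] is (n+1)
    s t times the mean squared increment of [h]. The Poincare constant (n+1) s^2 t^2 leaves the
    factor 1/(s t). *)
Lemma coherent_gap (R : realType) (s t : R) (n : nat) (u : nat -> R) :
  0 < s -> 0 < t -> s ^+ 2 + t ^+ 2 = 1 ->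
  - (n.+1%:R * (s / t)) * (\sum_(k < n.+2) u k ^+ 2) +
  (s * t)^-1 * (\sum_(k < n.+2) u k ^+ 2
                - (\sum_(k < n.+2) u k * coherent s t n.+1 k) ^+ 2) <=
  jacobi_form n.+1 (Ahc_weight R n.+1) (fun k => (t / s - s / t) * k%:R) u.
Proof.
move=> s0 t0 st; set N := n.+1; set x := coherent s t N.
have s1 : s != 0 by rewrite gt_eqF.
have t1 : t != 0 by rewrite gt_eqF.
have p01 : 0 <= s ^+ 2 <= 1 by rewrite sqr_ge0 -st lerDl sqr_ge0.
pose h k := u k / x k.
have xh k : (k <= N)%N -> x k * h k = u k.
  by move=> kn; rewrite /h mulrC divfK // gt_eqF // coherent_gt0.
have x2 k : (k <= N)%N ->
    'C(N, k)%:R * (s ^+ 2) ^+ k * (1 - s ^+ 2) ^+ (N - k) = x k ^+ 2.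
  by move=> kn; rewrite -(coherent_sqr kn st).
have mean2 : binomial_mean (s ^+ 2) N (fun k => h k ^+ 2) =
    \sum_(k < N.+1) u k ^+ 2.
  by apply: eq_bigr => k _; rewrite x2 ?leq_ord // -exprMn xh ?leq_ord.
have mean1 : binomial_mean (s ^+ 2) N h = \sum_(k < N.+1) u k * x k.
  apply: eq_bigr => k _.
  by rewrite x2 ?leq_ord // expr2 -mulrA xh ?leq_ord // mulrC.
have := jacobi_ground_state_transform h (Ahc_weight0 R N) (Ahc_weightS R N)
  (@coherent_eigen R s t N s1 t1).
have -> : jacobi_form N (Ahc_weight R N) (fun k => (t / s - s / t) * k%:R)
   (fun k => coherent s t N k * h k) =
   jacobi_form N (Ahc_weight R N) (fun k => (t / s - s / t) * k%:R) u.
  rewrite /jacobi_form; congr (_ - 2 * _); apply: eq_bigr => k _.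
    by rewrite xh // -ltnS.
  by rewrite -[LHS]mulrA xh 1?ltnW // xh // mulrA.
have -> : \sum_(k < N.+1) (coherent s t N k * h k) ^+ 2 =
    \sum_(k < N.+1) u k ^+ 2.
  by apply: eq_bigr => k _; rewrite xh // -ltnS.
move=> ->; rewrite lerD2l.
have -> : \sum_(k < N) Ahc_weight R N k.+1 * coherent s t N k *
    coherent s t N k.+1 * (h k.+1 - h k) ^+ 2 =
    N%:R * (s * t) *
      binomial_mean (s ^+ 2) n (fun k => (h k.+1 - h k) ^+ 2).
  rewrite /binomial_mean mulr_sumr; apply: eq_bigr => k _.
  by rewrite coherent_hop // 1?[RHS]mulrA // -ltnS.
rewrite mulrC ler_pdivrMr ?mulr_gt0 // -mean1 -mean2.
apply: le_trans (binomial_poincare n h p01) _.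
have q : 1 - s ^+ 2 = t ^+ 2 by rewrite -st; ring.
by rewrite q -/N le_eqVlt; apply/orP; left; apply/eqP; ring.
Qed.

(** Since 1 - 2 s^2 = t^2 - s^2, the slope hypothesis is s t times the equality of t/s - s/t with
    the derivative of [Vq] at the mean. *)
Lemma quadratic_overlap (R : realType) (n : nat) (k0 a s t E : R)
    (u : nat -> R) :
  0 <= a -> k0 <= 0 -> 0 < s -> 0 < t -> s ^+ 2 + t ^+ 2 = 1 ->
  2 * a * (n.+1%:R * s ^+ 2 - k0) * (s * t) = 1 - 2 * s ^+ 2 ->
  jacobi_eigen n.+1 (Ahc_weight R n.+1) (Vq a k0) E u ->
  (forall k, (k <= n.+1)%N -> 0 < u k) ->
  \sum_(k < n.+2) u k ^+ 2 = 1 ->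
  2^-1 <= (\sum_(k < n.+2) u k * coherent s t n.+1 k) ^+ 2.
Proof.
move=> a0 k00 s0 t0 st slope uE u0 u1.
set N := n.+1 in slope *; set x := coherent s t N; set w := Ahc_weight R N.
have s1 : s != 0 by rewrite gt_eqF.
have t1 : t != 0 by rewrite gt_eqF.
have p01 : 0 <= s ^+ 2 <= 1 by rewrite sqr_ge0 -st lerDl sqr_ge0.
have q : 1 - s ^+ 2 = t ^+ 2 by rewrite -st; ring.
have x2 : binomial_mean (s ^+ 2) N =1
    fun f : nat -> R => \sum_(k < N.+1) f k * x k ^+ 2.
  by move=> f; apply: eq_bigr => k _;
    rewrite -(coherent_sqr _ st) 1?mulrC // -ltnS.
have x1 : \sum_(k < N.+1) x k ^+ 2 = 1.
  rewrite -[RHS](binomial_mean_cst (s ^+ 2) N 1) x2.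
  by apply: eq_bigr => k _; rewrite mul1r.
pose mu := N%:R * s ^+ 2.
pose L k : R := (t / s - s / t) * k%:R.
have VL k : Vq a k0 k - L k = a * (k%:R - mu) ^+ 2 + a * (k0 ^+ 2 - mu ^+ 2).
  have -> : L k = 2 * a * (mu - k0) * k%:R.
    rewrite /L; congr (_ * _); apply: (@mulIf _ (s * t)).
      by rewrite mulf_neq0.
    rewrite slope mulrBl; rewrite -{1}st; field.
    by rewrite s1 t1.
  by rewrite /Vq; ring.
have split_form (y : nat -> R) : \sum_(k < N.+1) y k ^+ 2 = 1 ->
    jacobi_form N w (Vq a k0) y = jacobi_form N w L y +
      a * (\sum_(k < N.+1) (k%:R - mu) ^+ 2 * y k ^+ 2)
      + a * (k0 ^+ 2 - mu ^+ 2).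
  move=> y1; have := jacobi_formB N w (Vq a k0) L y.
  move/eqP; rewrite subr_eq => /eqP ->; rewrite -addrA [RHS]addrC.
  congr (_ + _).
  transitivity (\sum_(k < N.+1) (a * ((k%:R - mu) ^+ 2 * y k ^+ 2)
    + a * (k0 ^+ 2 - mu ^+ 2) * y k ^+ 2)); last first.
    by rewrite big_split -!mulr_sumr y1 mulr1.
  by apply: eq_bigr => k _; rewrite VL; ring.
have wge0 k : 0 <= w k by exact: sqrtr_ge0.
have w0 : w 0%N = 0 by exact: Ahc_weight0.
have wN : w N.+1 = 0 by exact: Ahc_weightS.
have := jacobi_form_min x wge0 w0 wN uE u0.
have := jacobi_form_eigen w0 wN uE.
have := coherent_gap n u s0 t0 st.
have := jacobi_form_eigen w0 wN (@coherent_eigen R s t N s1 t1).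
rewrite -/N -/x -/w -/L x1 u1 !mulr1 !split_form //.
(* The Poincare inequality for k - mu, whose increments are all 1. *)
have var_x : \sum_(k < N.+1) (k%:R - mu) ^+ 2 * x k ^+ 2 <=
    N%:R * s ^+ 2 * t ^+ 2.
  rewrite -[leLHS](x2 (fun k => (k%:R - mu) ^+ 2)).
  have := binomial_poincare n (fun k => k%:R - mu) p01.
  rewrite /binomial_var binomial_meanB binomial_mean_id binomial_mean_cst.
  rewrite subrr expr0n subr0 q; congr (_ <= _).
  rewrite (_ : (fun k => _) = fun=> 1) ?binomial_mean_cst ?mulr1 //.
  by apply/funext => k; rewrite -natr1; ring.
have var_u : 0 <= \sum_(k < N.+1) (k%:R - mu) ^+ 2 * u k ^+ 2.
  by apply: sumr_ge0 => k _; rewrite mulr_ge0 ?sqr_ge0.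
have {var_x}ax := ler_wpM2l a0 var_x; have {var_u}au := mulr_ge0 a0 var_u.
move=> Lx Lu Vu Vx.
set ov := \sum_(k < N.+1) u k * x k in Lu *.
(* Chaining the four energy relations cancels [E], the energy of [x] and the constant a (k0^2 -
   mu^2); the spread of [u] around [mu] is dropped by its sign. *)
have : (s * t)^-1 * (1 - ov ^+ 2) <= a * (N%:R * s ^+ 2 * t ^+ 2) by lra.
rewrite mulrC ler_pdivrMr ?mulr_gt0 // => gap.
have st0 : 0 <= a * (- k0) * (s * t).
  by rewrite mulr_ge0 ?mulr_ge0 ?oppr_ge0 // ltW // mulr_gt0.
(* The slope equation writes 1 - 2 s^2 as twice the left-hand side plus a term that is nonnegative
   because k0 <= 0. *)
have slope_le : a * N%:R * s ^+ 2 * (s * t) <= 2^-1.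
  have : 2 * a * (N%:R * s ^+ 2 - k0) * (s * t) =
    2 * (a * N%:R * s ^+ 2 * (s * t)) + 2 * (a * (- k0) * (s * t)) by ring.
  rewrite slope; have := sqr_ge0 s; lra.
have t2 : t ^+ 2 <= 1 by rewrite -st lerDr sqr_ge0.
have : a * (N%:R * s ^+ 2 * t ^+ 2) * (s * t) <= 2^-1.
  rewrite (_ : _ * _ = a * N%:R * s ^+ 2 * (s * t) * t ^+ 2); last by ring.
  by rewrite -[leRHS]mulr1 ler_pM ?sqr_ge0 // !mulr_ge0 ?sqr_ge0 // ltW.
lra.
Qed.

(** * Choice of the parameter p *)

(** Intermediate value theorem on [0, 1/2]. The slope t/s - s/t blows up at p = 0; after
    multiplication by s t the equation is continuous there. *)
Lemma quadratic_tangency (R : realType) (n : nat) (k0 a : R) :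
  0 <= a -> k0 <= 0 ->
  exists p : R, [/\ 0 < p, p <= 2^-1 &
    2 * a * (n%:R * p - k0) * (Num.sqrt p * Num.sqrt (1 - p)) = 1 - 2 * p].
Proof.
move=> a0 k00.
pose f (p : R) : R :=
  2 * a * (n%:R * p - k0) * (Num.sqrt p * Num.sqrt (1 - p)) - (1 - 2 * p).
have fc : continuous (f : R -> R).
  move=> p; have idc : {for p, continuous (@id R)} by exact: cvg_id.
  have sc : {for p, continuous (fun p : R => Num.sqrt p)}.
    exact: sqrt_continuous.
  have tc : {for p, continuous (fun p : R => Num.sqrt (1 - p))}.
    apply: (@continuous_comp _ _ _ (fun p : R => 1 - p)).
      by apply: cvgB; [exact: cvg_cst | exact: idc].
    exact: sqrt_continuous.
  apply: cvgB; last first.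
    by apply: cvgB; last apply: cvgM; by [exact: cvg_cst | exact: idc].
  apply: cvgM; last by apply: cvgM.
  apply: cvgM; first exact: cvg_cst.
  by apply: cvgB; [apply: cvgM; [exact: cvg_cst | exact: idc] | exact: cvg_cst].
have f0 : f 0 = -1 by rewrite /f sqrtr0; ring.
have f2 : 0 <= f 2^-1.
  have slope0 : 0 <= n%:R / 2 - k0.
    by rewrite subr_ge0 (le_trans k00) // divr_ge0.
  rewrite /f divff ?pnatr_eq0 // subrr subr0.
  by rewrite !mulr_ge0 ?sqrtr_ge0.
have ivt : Num.min (f 0) (f 2^-1) <= 0 <= Num.max (f 0) (f 2^-1).
  by rewrite ge_min le_max f0 f2 lerN10 orbT.
have half0 : 0 <= 2^-1 :> R by rewrite invr_ge0.
have [p] := IVT half0 (continuous_subspaceT fc) ivt.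
rewrite in_itv /= => /andP[p0 p2] fp.
exists p; split=> //; last by apply/eqP; rewrite -subr_eq0 -/(f p) fp.
(* The root is not 0, because [f 0] is -1. *)
rewrite lt_neqAle p0 andbT; apply/eqP => p_eq0.
by move/eqP: fp; rewrite -p_eq0 f0 oppr_eq0 oner_eq0.
Qed.

(** * From complex matrices to real sequences *)

Lemma binomial_stateE (R : realType) (n : nat) (p : R) (k : 'I_n.+1) :
  n != 0%N -> 0 <= p <= 1 ->
  binomial_state n (n%:R * p) k ord0 =
  (coherent (Num.sqrt p) (Num.sqrt (1 - p)) n k)%:C.
Proof.
move=> n0 /andP[p0 p1]; rewrite mxE.
have -> : n%:R * p / n%:R = p by rewrite mulrAC divff ?mul1r // pnatr_eq0.
have q0 : 0 <= 1 - p by rewrite subr_ge0.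
rewrite -natrB ?leq_ord // ![_%:R / 2]mulrC !powRrM !powR12_sqrt //.
by rewrite !powR_mulrn ?sqrtr_ge0.
Qed.

Lemma braket_real (R : realType) (N : nat) (u v : 'I_N -> R)
    (x y : 'cV[R[i]]_N) :
  (forall k, x k ord0 = (u k)%:C) -> (forall k, y k ord0 = (v k)%:C) ->
  braket x y = (\sum_k u k * v k)%:C.
Proof.
move=> xu yv; rewrite /braket mxE rmorph_sum /=; apply: eq_bigr => k _.
by rewrite !mxE xu yv rmorphM /= -[in RHS]conjc_real.
Qed.

(** Row [k] of [Ahc] applied to [x]. The two tests exclude each other, and the vanishing end weights
    account for the missing neighbours at k = 0 and k = n. *)
Lemma sum_hopping (R : realType) (n k : nat) (w x : nat -> R) :
  (k <= n)%N -> w 0%N = 0 -> w n.+1 = 0 ->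
  \sum_(j < n.+1) (if j == k.+1 :> nat then w j
                   else if k == j.+1 then w k else 0) * x j =
  w k * x k.-1 + w k.+1 * x k.+1.
Proof.
move=> kn w0 wn.
transitivity (\sum_(j < n.+1 | k == j.+1) w k * x j +
              \sum_(j < n.+1 | j == k.+1 :> nat) w j * x j).
  rewrite [X in _ = X + _]big_mkcond [X in _ = _ + X]big_mkcond -big_split /=.
  apply: eq_bigr => j _; case: eqP => [->|_].
    by rewrite -addn2 -[X in X == _]addn0 eqn_add2l add0r.
  by case: eqP; rewrite ?mul0r addr0.
congr (_ + _).
  case: k kn => [|k] kn; first by rewrite big_pred0 ?w0 ?mul0r.
  under eq_bigl do rewrite eqSS eq_sym.
  by rewrite (big_ord1_eq _ (fun j => w k.+1 * x j)) ltnW.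
rewrite (big_ord1_eq _ (fun j => w j * x j)) ltnS; case: ltnP => // nk.
by rewrite (@anti_leq k n) ?kn // wn mul0r.
Qed.

(** The entries of [Hq] and of [psi] are real, so the real part of the equation involves [E] only
    through its real part. *)
Lemma Hq_jacobi_eigen (R : realType) (n : nat) (a k0 : R) (E : R[i])
    (psi : 'cV[R[i]]_n.+1) (u : nat -> R) :
  (forall k : 'I_n.+1, psi k ord0 = (u k)%:C) ->
  Hq n a k0 *m psi = E *: psi ->
  jacobi_eigen n (Ahc_weight R n) (Vq a k0) (complex.Re E) u.
Proof.
move=> psiu Hpsi k kn; pose K := Ordinal (kn : (k < n.+1)%N).
have := congr1 (fun M : 'cV[R[i]]_n.+1 => complex.Re (M K ord0)) Hpsi.
rewrite /Hq mulmxDl mulNmx mul_diag_mx !mxE !psiu.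
have -> : \sum_j Ahc R n K j * psi j ord0 =
    (\sum_(j < n.+1) (if j == k.+1 :> nat then Ahc_weight R n j
       else if k == j.+1 then Ahc_weight R n k else 0) * u j)%:C.
  rewrite rmorph_sum; apply: eq_bigr => j _ /=.
  by rewrite mxE psiu rmorphM /=; case: ifP => // _; case: ifP.
rewrite sum_hopping ?Ahc_weight0 ?Ahc_weightS //.
rewrite -rmorphN -rmorphM -rmorphD /= => e.
rewrite addrC e; case: E {Hpsi e} => e1 e2 /=.
by rewrite mulr0 subr0.
Qed.

Theorem theorem7 (R : realType) (n : nat) (k0 a : R) (psi : 'cV[R[i]]_n.+1)
    (hn : (1 <= n)%N) (hk0 : k0 <= 0) (ha : 0 <= a)
    (hpsi : ground_state (Hq n a k0) psi) :
  exists m : R, 0 <= m <= n%:R / 2 /\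
    2^-1 <= `|braket psi (binomial_state n m)| ^+ 2.
Proof.
have [p [p0 p2 slope]] := quadratic_tangency n ha hk0.
have p1 : p < 1 by apply: le_lt_trans p2 _; rewrite invf_lt1 ?ltr1n.
exists (n%:R * p); split; first by rewrite ler_wpM2l // andbT mulr_ge0 // ltW.
have [E [_ Hpsi psi1 psi0]] := hpsi.
(* Beyond [n], [inord] falls back to index 0; that value of [u] only meets the zero weight at
   [n.+1]. *)
pose u k : R := complex.Re (psi (inord k) ord0).
(* Positivity in the order of [R[i]] forces the imaginary part to vanish. *)
have psiu (k : 'I_n.+1) : psi k ord0 = (u k)%:C.
  have := psi0 k; rewrite /u inord_val ltcE => /andP[/eqP /= im0 _].
  by case: (psi k ord0) im0 => x y /= ->.
have u0 k : (k <= n)%N -> 0 < u k.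
  move=> kn; have := psi0 (Ordinal (kn : (k < n.+1)%N)).
  by rewrite psiu ltcR.
have u1 : \sum_(k < n.+1) u k ^+ 2 = 1.
  by apply: complexI; move: psi1; rewrite (braket_real psiu psiu).
have uE := Hq_jacobi_eigen psiu Hpsi.
have p01 : 0 <= p <= 1 by rewrite !ltW.
have phiE k := binomial_stateE k (lt0n_neq0 hn) p01.
rewrite (braket_real psiu phiE).
rewrite normc_def /= expr0n /= addr0 sqrtr_sqr -rmorphXn /=.
rewrite real_normK ?num_real //.
have -> : 2^-1 = (2^-1 : R)%:C.
  by rewrite rmorphV ?unitfE ?pnatr_eq0 // rmorph_nat.
rewrite lecR.
have s2 : Num.sqrt p ^+ 2 = p by rewrite sqr_sqrtr // ltW.
have t2 : Num.sqrt (1 - p) ^+ 2 = 1 - p by rewrite sqr_sqrtr // subr_ge0 ltW.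
case: n hn psi hpsi Hpsi psi1 psi0 u psiu phiE slope u0 u1 uE => // n _ psi.
move=> _ _ _ _ u _ _ slope u0 u1 uE.
apply: (quadratic_overlap ha hk0 _ _ _ _ uE) => //.
- by rewrite sqrtr_gt0.
- by rewrite sqrtr_gt0 subr_gt0.
- by rewrite s2 t2 addrC subrK.
- by rewrite s2.
Qed.
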